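(* Let $w$ be an integer with $w-1\equiv1$ or $3\pmod6$, let $k$ be the largest integer such that $2^k$ divides $w$, and let $i\in\{0,\ldots,k\}$. Then the total number of different STS$(w-1)$ on $\{1,\ldots,w-1\}$ of $2$-rank $w-i-1$ equals $$\dot\Gamma_{w,0,i}\sum_{j=i}^k\dot\Gamma_{w,i,j}\,\mu^{(2)}_{j-i}\,\dot\Phi_{w-1,j},$$ where $\mu^{(2)}_l=(-1)^l2^{\binom l2}$, $\dot\Phi_{w-1,j}=\Psi_{w/2^j-1}\,\Pi_{w/2^j-1}^{\,2^j-1}\,\Lambda_{w/2^j}^{\,(2^j-1)(2^j-2)/6}$, $$\dot\Gamma_{w,i,j}=\left(\left(\tfrac{w}{2^i}\right)!\right)^{2^i}\Bigg/\left(2^{\frac{(j-i)(j+i+1)}2}\left(\left(\tfrac{w}{2^j}\right)!\right)^{2^j}\prod_{s=1}^{j-i}(2^s-1)\right),$$ $\Psi_u$ is the number of STS$(u)$ on $\{1,\ldots,u\}$, $\Pi_u$ is the number of symmetric latin squares of order $u$, and $\Lambda_u$ is the number of latin squares of order $u$.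
   Context: A Steiner triple system STS$(n)$ on $\{1,\ldots,n\}$ is a collection of 3-subsets (blocks) such that every 2-subset is contained in exactly one block; systems are different when their block sets differ. The $2$-rank of an STS is the dimension of the $\mathrm{GF}(2)$-span of the characteristic vectors of its blocks in $\mathrm{GF}(2)^n$. A latin square of order $u$ is a function $f:\{1,\ldots,u\}^2\to\{1,\ldots,u\}$ bijective in each argument; it is symmetric if $f(x,y)=f(y,x)$. Conventions: $\Psi_0=\Pi_0=1$, $\Psi_1=1$, and $\Psi_u=0$ if no STS$(u)$ exists. *)

(* Defs.v *)
From mathcomp Require Import all_boot all_order all_algebra.
Set Implicit Arguments. Unset Strict Implicit. Unset Printing Implicit Defensive.
Import GRing.Theory Num.Theory.

(* Points {1,...,n} are represented by 'I_n = {0,...,n-1}. *)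

Definition is_STS (n : nat) (B : {set {set 'I_n}}) : bool :=
  [forall b in B, #|b| == 3] &&
  [forall p : {set 'I_n}, (#|p| == 2) ==> (#|[set b in B | p \subset b]| == 1)].

Definition inc_mx (n : nat) (B : {set {set 'I_n}}) : 'M['F_2]_(#|B|, n) :=
  \matrix_(b < #|B|, x < n) ((x \in @enum_val _ (mem B) b)%:R)%R.

Definition rank2 (n : nat) (B : {set {set 'I_n}}) : nat := \rank (inc_mx B).

Definition num_STS_rank (n r : nat) : nat :=
  #|[set B : {set {set 'I_n}} | is_STS B && (rank2 B == r)]|.

(* Psi_u : number of STS(u) on u points (gives Psi_0 = Psi_1 = 1, and 0 if none). *)
Definition Psi (u : nat) : nat := #|[set B : {set {set 'I_u}} | is_STS B]|.

Definition bijb (T : finType) (g : T -> T) : bool :=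
  injectiveb g && [forall z, z \in codom g].

Definition is_latin (u : nat) (f : {ffun 'I_u * 'I_u -> 'I_u}) : bool :=
  [forall x, bijb (fun y => f (x, y))] && [forall y, bijb (fun x => f (x, y))].

Definition is_symmetric (u : nat) (f : {ffun 'I_u * 'I_u -> 'I_u}) : bool :=
  [forall x, forall y, f (x, y) == f (y, x)].

Definition Lambda (u : nat) : nat :=
  #|[set f : {ffun 'I_u * 'I_u -> 'I_u} | is_latin f]|.

Definition Pi (u : nat) : nat :=
  #|[set f : {ffun 'I_u * 'I_u -> 'I_u} | is_latin f && is_symmetric f]|.

Local Open Scope ring_scope.

Definition mu2 (l : nat) : rat := (-1) ^+ l * (2 ^ 'C(l, 2))%N%:R.

(* dot-Phi_{w-1,j} (indexed here by w) *)
Definition Phidot (w j : nat) : nat :=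
  (Psi (w %/ 2 ^ j).-1 * Pi (w %/ 2 ^ j).-1 ^ (2 ^ j).-1
   * Lambda (w %/ 2 ^ j) ^ (((2 ^ j - 1) * (2 ^ j - 2)) %/ 6))%N.

Definition Gammadot (w i j : nat) : rat :=
  (((w %/ 2 ^ i)`! ^ (2 ^ i))%N%:R) /
  ((2 ^ (((j - i) * (j + i + 1)) %/ 2))%N%:R
   * (((w %/ 2 ^ j)`! ^ (2 ^ j))%N%:R)
   * \prod_(1 <= s < (j - i).+1) ((2 ^ s)%N%:R - 1)).

(* Main.v *)
Require Import Defs.
From mathcomp Require Import all_boot all_order all_algebra.
From mathcomp Require Import mxabelem.
From mathcomp Require Import zify ring.
Set Implicit Arguments. Unset Strict Implicit. Unset Printing Implicit Defensive.
Import GRing.Theory.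

(** Count pairs (B, F), where B is an STS on w - 1 points and F : points -> F_2^j
    has rank j and sums to 0 on every block of B (the columns of F are j independent
    words of the dual code of B). For fixed B with dual dimension d their number is
    prod_(s < j) (2^d - 2^s). Conversely, for fixed F the involution exchanging the two
    other points of the blocks through x shows that all fibers of F have size
    m = w / 2^j, except that the fiber of 0 has size m - 1; and the STS compatible
    with such an F split into independent pieces according to the image of a block:
    an STS(m - 1) on the fiber of 0, a one-factorization (that is, a symmetric latin
    square of order m - 1) for each nonzero a, and a latin square of order m for each
    line {a, b, a + b}. Inverting the resulting triangular system by the
    alternating 2-binomial identity gives the number of STS of each rank. *)

(** * Designs split by block type *)

Lemma card_bij_in (aT rT : finType) (A : {set aT}) (B : {set rT}) (f : aT -> rT) :
    {in A, forall x, f x \in B} -> {in A &, injective f} ->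
    {in B, forall y, exists2 x, x \in A & f x = y} ->
  #|A| = #|B|.
Proof.
move=> fAB finj fsurj; rewrite -(card_in_imset finj).
apply/eq_card => y; apply/imsetP/idP => [[x Ax ->]|/fsurj[x Ax <-]]; first exact: fAB.
by exists x.
Qed.

Lemma bijbP (T : finType) (g : T -> T) : reflect (injective g) (bijb g).
Proof.
apply: (iffP andP) => [[/injectiveP]//|g_inj]; split; first exact/injectiveP.
apply/forallP => z; have [h _ gK] := injF_bij g_inj.
by rewrite -(gK z) codom_f.
Qed.

Section Designs.

Variable T : finType.
Implicit Types (Tr Pr B : {set {set T}}).

(** The allowed blocks [Tr] and the sets to be covered [Pr] are arbitrary, so that Steiner systems,
    latin squares and one-factorizations are all instances of one notion. *)
Definition design Tr Pr B : bool :=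
  (B \subset Tr) && [forall p in Pr, #|[set b in B | p \subset b]| == 1].

Definition designs Tr Pr := [set B | design Tr Pr B].

Lemma designP Tr Pr B :
  reflect ({subset B <= Tr} /\
           {in Pr, forall p : {set T}, exists2 b, b \in B &
              p \subset b /\ {in B, forall b' : {set T}, p \subset b' -> b' = b}})
          (design Tr Pr B).
Proof.
apply: (iffP andP) => [[/subsetP sBTr /forall_inP cov]|[sBTr cov]].
  split=> // p /cov /cards1P[b bP]; exists b.
    by have := set11 b; rewrite -bP inE => /andP[].
  split=> [|b' Bb' pb']; first by have := set11 b; rewrite -bP inE => /andP[].
  by apply/set1P; rewrite -bP inE Bb'.
split; first exact/subsetP.
apply/forall_inP => p /cov[b Bb [pb bU]]; apply/cards1P; exists b.
apply/setP => b'; rewrite !inE; apply/andP/eqP => [[Bb' pb']|->//].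
exact: bU.
Qed.

Lemma design_uniq Tr Pr B p b b' : design Tr Pr B -> p \in Pr ->
  b \in B -> b' \in B -> p \subset b -> p \subset b' -> b = b'.
Proof.
move=> /designP[_ cov] /cov[c _ [_ cU]] Bb Bb' pb pb'.
by rewrite (cU b) // (cU b').
Qed.

(** A further block of [B'] would contain some [p] in [Pr], already covered by a block of [B], hence
    covered twice in [B']. When a design is decoded into a square, one inclusion therefore
    suffices. *)
Lemma design_sub_eq Tr Pr B B' :
    {in Tr, forall b : {set T}, exists2 p : {set T}, p \in Pr & p \subset b} ->
    design Tr Pr B -> design Tr Pr B' -> B \subset B' ->
  B = B'.
Proof.
move=> TrPr dB dB' sBB'; apply/eqP; rewrite eqEsubset sBB'; apply/subsetP => b' B'b'.
have /designP[sB'Tr _] := dB'; have /designP[_ covB] := dB.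
have [p Prp pb'] := TrPr _ (sB'Tr _ B'b').
have [b Bb [pb _]] := covB p Prp.
by rewrite (design_uniq dB' Prp B'b' (subsetP sBB' _ Bb) pb' pb).
Qed.

(** A block can only cover pairs of its own label, so the covering conditions for different labels
    do not interact: cutting a design by label and taking the union of the pieces are mutually
    inverse. *)
Lemma card_designs_prod (I : finType) (labT labP : {set T} -> I) Tr Pr :
    {in Tr & Pr, forall b p : {set T}, p \subset b -> labT b = labP p} ->
  #|designs Tr Pr| =
  \prod_i #|designs [set b in Tr | labT b == i] [set p in Pr | labP p == i]|.
Proof.
move=> lab_eq.
pose F i := designs [set b in Tr | labT b == i] [set p in Pr | labP p == i].
pose cut B := [ffun i => [set b in B | labT b == i]].
have cutE B i b : (b \in cut B i) = (b \in B) && (labT b == i) by rewrite ffunE inE.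
transitivity #|[set g in family F]|; last first.
  by rewrite cardsE card_family foldrE big_map big_enum.
apply: (@card_bij_in _ _ _ _ cut) => [B|B B' _ _ eqBB'|g].
- rewrite !inE => /designP[sBTr cov]; apply/familyP => i; rewrite inE.
  apply/designP; split=> [b|p]; first by rewrite cutE inE => /andP[/sBTr-> ->].
  rewrite inE => /andP[Prp /eqP pi]; have [b Bb [pb bU]] := cov p Prp.
  exists b; first by rewrite cutE Bb (lab_eq _ _ (sBTr _ Bb) Prp pb) pi eqxx.
  by split=> // b'; rewrite cutE => /andP[Bb' _]; apply: bU.
- apply/setP => b.
  by have := congr1 (fun g : {ffun I -> {set {set T}}} => b \in g (labT b)) eqBB';
    rewrite !cutE eqxx !andbT.
rewrite inE => /familyP gF; have {}gF i : design [set b in Tr | labT b == i] [set p in Pr | labP p == i] (g i) by have := gF i; rewrite inE.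
have gsub i b : b \in g i -> (b \in Tr) && (labT b == i).
  by have /designP[sub _] := gF i; move=> /sub; rewrite inE.
exists (\bigcup_i g i).
  rewrite inE; apply/designP; split=> [b /bigcupP[i _ /gsub/andP[]]//|p Prp].
  have /designP[_ cov] := gF (labP p).
  have [|b gb [pb bU]] := cov p; first by rewrite inE Prp eqxx.
  exists b; first by apply/bigcupP; exists (labP p).
  split=> // b' /bigcupP[i _ gb'] pb'; apply: bU => //.
  have /andP[Trb' /eqP ib'] := gsub _ _ gb'.
  by rewrite -(lab_eq _ _ Trb' Prp pb') ib'.
apply/ffunP => i; apply/setP => b; rewrite cutE.
apply/andP/idP => [[/bigcupP[j _ gb] /eqP<-]|gb].
  by have /andP[_ /eqP->] := gsub _ _ gb.
by have /andP[_ ->] := gsub _ _ gb; split=> //; apply/bigcupP; exists i.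
Qed.

Lemma card_designs_none : #|designs set0 set0| = 1.
Proof.
apply/eqP/cards1P; exists set0; apply/setP => B; rewrite !inE /design subset0.
by case: (B == set0) => //=; apply/forall_inP => p; rewrite inE.
Qed.

End Designs.

Lemma card_designs_imset (T U : finType) (e : T -> U) (Tr Pr : {set {set T}}) :
  injective e ->
  #|designs [set e @: b | b : {set T} in Tr] [set e @: p | p : {set T} in Pr]|
  = #|designs Tr Pr|.
Proof.
move=> e_inj; have ie_inj := imset_inj e_inj; symmetry.
have subE (p b : {set T}) : (e @: p \subset e @: b) = (p \subset b).
  apply/idP/idP => [/subsetP sub|]; last exact: imsetS.
  by apply/subsetP => x /(imset_f e)/sub; rewrite mem_imset.
apply: (@card_bij_in _ _ _ _ (fun B : {set {set T}} => [set e @: (b : {set T}) | b in B])).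
- move=> B; rewrite !inE => /designP[sub cov]; apply/designP; split.
    by move=> _ /imsetP[b /sub Trb ->]; apply: imset_f.
  move=> _ /imsetP[p /cov[b Bb [pb bU]] ->]; exists (e @: b); first exact: imset_f.
  rewrite subE; split=> // _ /imsetP[b' Bb' ->]; rewrite subE => pb'.
  by rewrite (bU b').
- by move=> B B' _ _; apply: imset_inj.
move=> B; rewrite inE => /designP[sub cov].
have eqB : [set e @: b | b : {set T} in [set b : {set T} | e @: b \in B]] = B.
  apply/setP => s; apply/imsetP/idP => [[b]|Bs]; first by rewrite inE => ? ->.
  by have /imsetP[b _ sE] := sub _ Bs; exists b; rewrite // inE -sE.
exists [set b : {set T} | e @: b \in B] => //.
rewrite inE; apply/designP; split=> [b|p Prp].
  by rewrite inE => /sub; rewrite mem_imset.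
have [|s Bs] := cov (e @: p); first exact: imset_f.
move: (Bs); rewrite -{1}eqB => /imsetP[b Bb ->]; rewrite subE => -[pb bU].
exists b => //; split=> // b'; rewrite inE => Bb' pb'; apply: ie_inj.
by apply: bU; rewrite ?subE.
Qed.

Lemma is_STS_design n (B : {set {set 'I_n}}) :
  is_STS B = design [set b : {set _} | #|b| == 3] [set p : {set _} | #|p| == 2] B.
Proof.
congr andb; first by apply/forall_inP/subsetP => H b /H; rewrite inE.
by apply/forallP/forall_inP => H p; [rewrite inE => /(implyP (H p))|apply/implyP => /= p2;
  apply: H; rewrite inE].
Qed.

Lemma Psi_designs n :
  Psi n = #|designs [set b : {set 'I_n} | #|b| == 3] [set p : {set 'I_n} | #|p| == 2]|.
Proof. by apply: eq_card => B; rewrite !inE is_STS_design. Qed.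

(** * Transversals of three classes and latin squares *)

Section Latin.

Variables (T : finType) (m : nat) (ea eb ec : 'I_m -> T) (Tr Pr : {set {set T}}).
Hypotheses (a_inj : injective ea) (b_inj : injective eb) (c_inj : injective ec).
Hypotheses (ab : forall x y, ea x != eb y) (ac : forall x y, ea x != ec y)
  (bc : forall x y, eb x != ec y).
Hypothesis TrP : forall s, s \in Tr <-> exists x y z, s = [set ea x; eb y; ec z].
Hypothesis PrP : forall p, p \in Pr <->
  [\/ exists x y, p = [set ea x; eb y], exists x z, p = [set ea x; ec z]
    | exists y z, p = [set eb y; ec z]].

Let mem3 x y z : (ea x \in [set ea x; eb y; ec z]) * (eb y \in [set ea x; eb y; ec z])
  * (ec z \in [set ea x; eb y; ec z]).
Proof. by rewrite !inE !eqxx !orbT. Qed.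

Let memA x x' y' z' : (ea x \in [set ea x'; eb y'; ec z']) = (x == x').
Proof. by rewrite !inE (inj_eq a_inj) (negPf (ab _ _)) (negPf (ac _ _)) !orbF. Qed.
Let memB y x' y' z' : (eb y \in [set ea x'; eb y'; ec z']) = (y == y').
Proof. by rewrite !inE (inj_eq b_inj) eq_sym (negPf (ab _ _)) (negPf (bc _ _)) !orbF. Qed.
Let memC z x' y' z' : (ec z \in [set ea x'; eb y'; ec z']) = (z == z').
Proof.
by rewrite !inE (inj_eq c_inj) eq_sym (negPf (ac _ _)) eq_sym (negPf (bc _ _)).
Qed.
Let memABC := (memA, memB, memC).

(** A square [g] becomes the set of blocks row [x], column [y], symbol [g (x, y)]. The three kinds
    of pairs say that each cell is filled once and that each symbol occurs once in each row and once
    in each column. *)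
Lemma card_designs_latin : #|designs Tr Pr| = Lambda m.
Proof.
symmetry; pose blk (g : {ffun 'I_m * 'I_m -> 'I_m}) (u : 'I_m * 'I_m) := [set ea u.1; eb u.2;
  ec (g u)].
have TrPr : {in Tr, forall b : {set T}, exists2 p : {set T}, p \in Pr & p \subset b}.
  move=> _ /TrP[x [y [z ->]]]; exists [set ea x; eb y].
    by apply/PrP; constructor 1; exists x, y.
  by rewrite subUset !sub1set !mem3.
have blk_design g : is_latin g -> design Tr Pr [set blk g u | u in setT].
  move=> /andP[/forallP g_row /forallP g_col]; apply/designP; split.
    by move=> _ /imsetP[u _ ->]; apply/TrP; exists u.1, u.2, (g u).
  have [col_row] : (forall x z, exists y, g (x, y) = z) /\ (forall y z, exists x, g (x, y) = z).
    split=> [x|y] z; [have /andP[_ /forallP/(_ z)] := g_row x|have /andP[_ /forallP/(_ z)] :=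
      g_col y];
    by move=> /codomP[t ->]; exists t.
  move=> row_col p /PrP[[x [y ->]]|[x [z ->]]|[y [z ->]]].
  - exists (blk g (x, y)); first exact: imset_f.
    rewrite subUset !sub1set !mem3; split=> // _ /imsetP[[x' y'] _ ->].
    by rewrite subUset !sub1set !memABC => /= /andP[/eqP<- /eqP<-].
  - have [y gy] := col_row x z; exists (blk g (x, y)); first exact: imset_f.
    rewrite subUset !sub1set -gy !mem3; split=> // _ /imsetP[[x' y'] _ ->].
    rewrite subUset !sub1set !memABC => /andP[/eqP/= <- /eqP e].
    by have /bijbP g_inj := g_row x; rewrite (g_inj _ _ e).
  have [x gx] := row_col y z; exists (blk g (x, y)); first exact: imset_f.
  rewrite subUset !sub1set -gx !mem3; split=> // _ /imsetP[[x' y'] _ ->].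
  rewrite subUset !sub1set !memABC => /andP[/eqP/= <- /eqP e].
  by have /bijbP g_inj := g_col y; rewrite (g_inj _ _ e).
apply: (@card_bij_in _ _ _ _ (fun g => [set blk g u | u in setT])) => [g|g g' _ _ eqgg'|B].
- by rewrite !inE => /blk_design.
- apply/ffunP => -[x y].
  have : blk g (x, y) \in [set blk g' u | u in setT] by rewrite -eqgg' imset_f.
  move=> /imsetP[[x' y'] _]; rewrite /blk /= => eqb.
  by have := mem3 x y (g (x, y)); rewrite eqb !memABC => -[[/eqP<- /eqP<-] /eqP].
rewrite inE => dB; have /designP[sub cov] := dB.
have /fin_all_exists[g gP] (u : 'I_m * 'I_m) : exists z, [set ea u.1; eb u.2; ec z] \in B.
  have [|b Bb [pb _]] := cov [set ea u.1; eb u.2].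
    by apply/PrP; constructor 1; exists u.1, u.2.
  have /TrP[x' [y' [z bE]]] := sub _ Bb.
  move: pb Bb; rewrite bE subUset !sub1set !memABC => /= /andP[/eqP<- /eqP<-].
  by exists z.
have gB : [set blk (finfun g) u | u in setT] \subset B.
  by apply/subsetP => _ /imsetP[u _ ->]; rewrite /blk ffunE gP.
have lat : is_latin (finfun g).
  apply/andP; split; apply/forallP => x; apply/bijbP => y y'; rewrite !ffunE => e.
    have Prp : [set ea x; ec (g (x, y))] \in Pr.
      by apply/PrP; constructor 2; exists x, (g (x, y)).
    have := design_uniq dB Prp (gP (x, y)) (gP (x, y')).
    rewrite !subUset !sub1set !memABC e !eqxx => /(_ isT isT) /setP/(_ (eb y)).
    by rewrite !memABC eqxx => /esym/eqP.
  have Prp : [set eb x; ec (g (y, x))] \in Pr.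
    by apply/PrP; constructor 3; exists x, (g (y, x)).
  have := design_uniq dB Prp (gP (y, x)) (gP (y', x)).
  rewrite !subUset !sub1set !memABC e !eqxx => /(_ isT isT) /setP/(_ (ea y)).
  by rewrite !memABC eqxx => /esym/eqP.
exists (finfun g); first by rewrite inE.
exact: design_sub_eq TrPr (blk_design _ lat) dB gB.
Qed.

End Latin.

(** * One-factorizations and symmetric latin squares *)

Section OneFactorization.

Variables (T : finType) (u : nat) (e0 : 'I_u -> T) (ea : option 'I_u -> T).
Variables (Tr Pr : {set {set T}}).
Hypotheses (u_odd : (u == 0) || odd u).
Hypotheses (e0_inj : injective e0) (ea_inj : injective ea).
Hypothesis e0a : forall c o, e0 c != ea o.
Hypothesis TrP : forall s, s \in Tr <->
  exists c o o', o != o' /\ s = [set e0 c; ea o; ea o'].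
Hypothesis PrP : forall p, p \in Pr <->
  (exists c o, p = [set e0 c; ea o]) \/ (exists o o', o != o' /\ p = [set ea o; ea o']).

(** The diagonal will colour the edges at one extra vertex, where every colour must occur exactly
    once. This is where the parity of [u] enters; [u = 0] is vacuous. *)
Lemma diag_symmetric_latin (g : {ffun 'I_u * 'I_u -> 'I_u}) :
  is_latin g -> is_symmetric g -> bijective (fun x => g (x, x)).
Proof.
move=> /andP[/forallP g_row _] /forallP g_sym.
have {}g_sym x y : g (x, y) = g (y, x) by apply/eqP/(forallP (g_sym x)).
have onto c : exists x, g (x, x) = c.
  case/orP: u_odd => [/eqP u0|]; first by have := ltn_ord c; rewrite [X in _ < X]u0.
  have [/existsP[x /eqP]|/existsPn no_diag] := boolP [exists x, g (x, x) == c].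
    by exists x.
  (* Off the diagonal the cells with symbol [c] come in symmetric pairs. *)
  pose S := [set xy | g xy == c].
  have cardS : #|S| = u.
    rewrite -[RHS]card_ord -(card_imset (mem 'I_u) (f := fun x => (x, invF (bijbP _ (g_row x)) c))).
      apply: eq_card => -[x y]; rewrite inE; apply/eqP/imsetP => [gxy|[x' _ [-> ->]]].
        exists x => //; congr pair; apply: (bijbP _ (g_row x)).
        by rewrite gxy; symmetry; exact: (f_invF (bijbP _ (g_row x)) c).
      exact: (f_invF (bijbP _ (g_row x')) c).
    by move=> x x' [].
  have: ~~ odd #|S|.
    pose L := [set xy : 'I_u * 'I_u in S | xy.1 < xy.2].
    pose swap (xy : 'I_u * 'I_u) := (xy.2, xy.1).
    have swap_inj : injective swap by move=> [a b] [a' b'] [-> ->].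
    have SE : S = L :|: (swap @: L).
      apply/setP => -[x y]; rewrite !inE /=.
      have -> : ((x, y) \in swap @: L) = (g (x, y) == c) && (y < x).
        apply/imsetP/idP => [[[a b]]|/andP[gxy yx]].
          by rewrite !inE /= => /andP[gab ab] [-> ->]; rewrite g_sym gab.
        by exists (y, x) => //; rewrite !inE g_sym gxy.
      rewrite -andb_orr; case: eqP => //= gxy.
      case: ltngtP => // /val_inj exy; have := no_diag x.
      by move: gxy; rewrite -exy => ->; rewrite eqxx.
    have dis : L :&: (swap @: L) = set0.
      apply/setP => -[x y]; rewrite !inE /=; apply/negP => /andP[/andP[_ xy]].
      move=> /imsetP[[a b]]; rewrite !inE /= => /andP[_ ab] [ex ey].
      by move: xy; rewrite ex ey ltnNge ltnW.
    by rewrite SE cardsU dis cards0 subn0 card_imset // addnn odd_double.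
  by rewrite cardS => /negP.
have [h hP] := fin_all_exists onto.
have hK : cancel h (fun x => g (x, x)) by [].
have h_bij : bijective h by apply: injF_bij; apply: can_inj hK.
by exists h => //; apply/(bij_can_sym h_bij).
Qed.

Let mem3 c o o' : (e0 c \in [set e0 c; ea o; ea o']) * (ea o \in [set e0 c; ea o; ea o'])
  * (ea o' \in [set e0 c; ea o; ea o']).
Proof. by rewrite !inE !eqxx !orbT. Qed.

Let mem0 c c' o o' : (e0 c \in [set e0 c'; ea o; ea o']) = (c == c').
Proof. by rewrite !inE (inj_eq e0_inj) !(negPf (e0a _ _)) !orbF. Qed.
Let memA q c o o' : (ea q \in [set e0 c; ea o; ea o']) = (q == o) || (q == o').
Proof. by rewrite !inE !(inj_eq ea_inj) eq_sym (negPf (e0a _ _)). Qed.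

(* The loop extension: the vertex [None] is joined to [x] with colour [g (x, x)]. *)
Let partner (x y : 'I_u) := if x == y then None else Some y.

(** A block is an edge of the complete graph on [option 'I_u] together with its colour. A design is
    then a colouring of the edges by [u] colours in which each colour meets each vertex exactly
    once, that is, a one-factorization. *)
Lemma card_designs_sym_latin : #|designs Tr Pr| = Pi u.
Proof.
symmetry.
pose blk (g : {ffun 'I_u * 'I_u -> 'I_u}) (xy : 'I_u * 'I_u) :=
  [set e0 (g xy); ea (Some xy.1); ea (partner xy.1 xy.2)].
have partnerN x y : Some x != partner x y by rewrite /partner; case: (x =P y) => // xy;
  apply/eqP => -[].
have partner_inj x : injective (partner x).
  by move=> y y'; rewrite /partner; case: (x =P y) => [<-|_]; case: (x =P y') => [<-|_] // [].
have partner_onto x o : o != Some x -> exists y, partner x y = o.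
  case: o => [y yx|_]; last by exists x; rewrite /partner eqxx.
  by exists y; rewrite /partner; case: (x =P y) yx => // ->; rewrite eqxx.
have TrPr : {in Tr, forall b : {set T}, exists2 p : {set T}, p \in Pr & p \subset b}.
  move=> _ /TrP[c [o [o' [oo' ->]]]]; exists [set e0 c; ea o].
    by apply/PrP; left; exists c, o.
  by rewrite subUset !sub1set !mem3.
have blk_sym g x y : is_symmetric g -> x != y -> blk g (x, y) = blk g (y, x).
  move=> /forallP/(_ x)/forallP/(_ y)/eqP gs xy.
  by rewrite /blk /partner /= gs (eq_sym y) (negPf xy) setUAC.
have blk_design g : is_latin g -> is_symmetric g -> design Tr Pr [set blk g u | u in setT].
  move=> g_lat g_sym; have /andP[/forallP g_row _] := g_lat.
  have [d dK Kd] := diag_symmetric_latin g_lat g_sym.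
  (* By symmetry a block through [Some x] can be written with [x] as its row; its colour or its
     other vertex then determines the column. *)
  have at_vertex x y b : b \in [set blk g u | u in setT] ->
      ea (Some x) \in b -> (e0 (g (x, y)) \in b) || (ea (partner x y) \in b) -> b = blk g (x, y).
    move=> /imsetP[[x' y'] _ ->] xb.
    have [z ->] : exists z, blk g (x', y') = blk g (x, z).
      move: xb; rewrite memA /= => /orP[/eqP[->]|]; first by exists y'.
      rewrite /partner; case: (x' =P y') => // /eqP xy' /eqP[->].
      by exists x'; apply: blk_sym.
    rewrite mem0 memA /= => /or3P[/eqP/(bijbP _ (g_row x))->//||/eqP/partner_inj->//].
    by rewrite eq_sym (negPf (partnerN _ _)).
  (* Only diagonal cells give blocks through [None], and the diagonal is injective, so the colour
     alone determines such a block. *)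
  have at_None x b : b \in [set blk g u | u in setT] -> ea None \in b ->
      (e0 (g (x, x)) \in b) -> b = blk g (x, x).
    move=> /imsetP[[x' y'] _ ->]; rewrite memA /partner /=.
    case: (x' =P y') => // <- _; rewrite mem0 => /eqP e.
    by rewrite (can_inj dK e).
  apply/designP; split.
    move=> _ /imsetP[xy _ ->]; apply/TrP.
    by exists (g xy), (Some xy.1), (partner xy.1 xy.2).
  have some_pair x o : o != Some x -> exists2 b, b \in [set blk g u | u in setT] &
      [set ea (Some x); ea o] \subset b /\ {in [set blk g u | u in setT],
        forall b' : {set T}, [set ea (Some x); ea o] \subset b' -> b' = b}.
    move=> /partner_onto[y <-]; exists (blk g (x, y)); first exact: imset_f.
    rewrite subUset !sub1set !mem3; split=> // b' b'B.
    by rewrite subUset !sub1set => /andP[xb' yb']; apply: at_vertex; rewrite // yb' orbT.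
  move=> p /PrP[[c [[x|] ->]]|[[x|] [o [oo' ->]]]].
  - have /codomP[y cE] := forallP (andP (g_row x)).2 c.
    exists (blk g (x, y)); first exact: imset_f.
    rewrite subUset !sub1set cE !mem3; split=> // b' b'B.
    by rewrite subUset !sub1set => /andP[cb' xb']; apply: at_vertex; rewrite // cb'.
  - rewrite -[c]Kd; exists (blk g (d c, d c)); first exact: imset_f.
    rewrite subUset !sub1set {2}/blk /= /partner eqxx !mem3; split=> // b' b'B.
    by rewrite subUset !sub1set => /andP[cb' Nb']; apply: at_None.
  - by apply: some_pair; rewrite eq_sym.
  - by case: o oo' => // x _; rewrite setUC; apply: some_pair.
apply: (@card_bij_in _ _ _ _ (fun g => [set blk g u | u in setT])) => [g|g g'|B].
- by rewrite !inE => /andP[]; apply: blk_design.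
- rewrite !inE => /andP[g_lat g_sym] /andP[g'_lat g'_sym] eqgg'.
  apply/ffunP => -[x y].
  have gB : blk g (x, y) \in [set blk g' u | u in setT] by rewrite -eqgg' imset_f.
  have g'B : blk g' (x, y) \in [set blk g' u | u in setT] by rewrite imset_f.
  have Prp : [set ea (Some x); ea (partner x y)] \in Pr.
    by apply/PrP; right; exists (Some x), (partner x y).
  have := design_uniq (blk_design _ g'_lat g'_sym) Prp gB g'B.
  rewrite !subUset !sub1set !mem3 => /(_ isT isT)/setP/(_ (e0 (g (x, y)))).
  by rewrite !mem0 eqxx => /esym/eqP.
rewrite inE => dB; have /designP[sub cov] := dB.
have /fin_all_exists[g gP] (xy : 'I_u * 'I_u) :
    exists z, [set e0 z; ea (Some xy.1); ea (partner xy.1 xy.2)] \in B.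
  have [|b Bb [pb _]] := cov [set ea (Some xy.1); ea (partner xy.1 xy.2)].
    by apply/PrP; right; exists (Some xy.1), (partner xy.1 xy.2).
  have /TrP[c [o [o' [oo' bE]]]] := sub _ Bb.
  exists c; move: pb (partnerN xy.1 xy.2) Bb.
  rewrite bE subUset !sub1set !memA => /andP[].
  by case/orP=> /eqP-> /orP[]/eqP->; rewrite ?eqxx // => _; rewrite setUAC.
have gB : [set blk (finfun g) u | u in setT] \subset B.
  by apply/subsetP => _ /imsetP[xy _ ->]; rewrite /blk ffunE gP.
have g_sym : is_symmetric (finfun g).
  apply/forallP => x; apply/forallP => y; rewrite !ffunE.
  have [->//|xy] := eqVneq x y.
  have Prp : [set ea (Some x); ea (Some y)] \in Pr.
    by apply/PrP; right; exists (Some x), (Some y).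
  have := design_uniq dB Prp (gP (x, y)) (gP (y, x)).
  rewrite !subUset !sub1set !memA /partner /= (eq_sym y) (negPf xy) !eqxx !orbT.
  by move=> /(_ isT isT)/setP/(_ (e0 (g (x, y)))); rewrite !mem0 eqxx => /esym.
have row_inj x y y' : g (x, y) = g (x, y') -> y = y'.
  move=> e; have Prp : [set e0 (g (x, y)); ea (Some x)] \in Pr.
    by apply/PrP; left; exists (g (x, y)), (Some x).
  have := design_uniq dB Prp (gP (x, y)) (gP (x, y')).
  rewrite !subUset !sub1set !memA !mem0 e !eqxx => /(_ isT isT)/setP/(_ (ea (partner x y))).
  rewrite !memA eqxx orbT eq_sym (negPf (partnerN _ _)) => /esym/eqP.
  exact: partner_inj.
have g_lat : is_latin (finfun g).
  apply/andP; split; apply/forallP => x; apply/bijbP => y y'.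
    by rewrite !ffunE; apply: row_inj.
  have fg_sym a b : finfun g (a, b) = finfun g (b, a).
    by apply/eqP/(forallP (forallP g_sym a)).
  by rewrite fg_sym (fg_sym y') !ffunE; apply: row_inj.
exists (finfun g); first by rewrite inE g_lat.
exact: design_sub_eq TrPr (blk_design _ g_lat g_sym) dB gB.
Qed.

End OneFactorization.

(** * Pairs, triples and counting along the blocks through a point *)

Definition pairs (T : finType) := [set p : {set T} | #|p| == 2].

Lemma set3_sub_pair (T : finType) (b p : {set T}) :
  #|b| = 3 -> #|p| = 2 -> p \subset b -> exists2 z, z \notin p & b = z |: p.
Proof.
move=> b3 p2 pb; have /cards1P[z zE] : #|b :\: p| == 1.
  by rewrite cardsD (setIidPr pb) b3 p2.
exists z; first by have := set11 z; rewrite -zE inE => /andP[].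
by rewrite -[LHS](setID b p) (setIidPr pb) zE setUC.
Qed.

Lemma card_setD1 (T : finType) (A : {set T}) x : x \in A -> #|A :\ x| = #|A|.-1.
Proof. by move=> xA; rewrite (cardsD1 x A) xA. Qed.

Lemma sum_set2 (T : finType) (V : zmodType) (f : T -> V) x y : x != y ->
  (\sum_(z in [set x; y]) f z = f x + f y)%R.
Proof. by move=> xy; rewrite big_setU1 ?inE //= big_set1. Qed.

Lemma exists_enum (X T : finType) (A : {set T}) : #|X| = #|A| ->
  exists e : X -> T, [/\ injective e, forall i, e i \in A &
    forall x, x \in A -> exists i, x = e i].
Proof.
move=> XA; exists (fun i => enum_val (cast_ord XA (enum_rank i))); split.
- by move=> i i' /enum_val_inj/cast_ord_inj/enum_rank_inj.
- by move=> i; apply: enum_valP.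
move=> x xA; exists (enum_val (cast_ord (esym XA) (enum_rank_in xA x))).
by rewrite enum_valK cast_ordKV enum_rankK_in.
Qed.

(** Each point of [S] shares exactly one block with [x], so it is counted once on the right. *)
Lemma sum_block_meets (T : finType) (Tr B : {set {set T}}) (x : T) (S : {set T}) :
  design Tr (pairs T) B -> x \notin S ->
  #|S| = \sum_(b in B | x \in b) #|b :&: S|.
Proof.
move=> /designP[_ cov] xS.
transitivity (\sum_(y in S) \sum_(b in B | x \in b) (y \in b : nat)).
  rewrite -sum1_card; apply: eq_bigr => y yS.
  have [|b Bb [pb bU]] := cov [set x; y].
    by rewrite inE cards2; case: (x =P y) xS => // ->; rewrite yS.
  move: (pb); rewrite subUset !sub1set => /andP[xb yb].
  rewrite (bigD1 b) /= ?Bb // yb big1 ?addn0 // => b' /andP[/andP[Bb' xb'] /negP bb'].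
  apply/eqP; rewrite eqb0; apply/negP => yb'; apply: bb'.
  by apply/eqP/bU; rewrite // subUset !sub1set xb'.
rewrite exchange_big; apply: eq_bigr => b _.
by rewrite -sum1_card big_mkcond [RHS]big_mkcond; apply: eq_bigr => y _; rewrite inE andbC;
  case: (y \in S).
Qed.

(** The blocks through a fixed point split the other points into twos. *)
Lemma Psi_even u : u != 0 -> ~~ odd u -> Psi u = 0.
Proof.
case: u => // u _ /=; rewrite negbK => u_odd.
apply/eqP; rewrite cards_eq0; apply/set0Pn => -[B]; rewrite inE is_STS_design => dB.
have := sum_block_meets dB (negbT (setC11 ord0)).
rewrite cardsC1 card_ord (eq_bigr (fun=> 2)).
  by rewrite sum_nat_const => e; move: u_odd; rewrite [u]e oddM andbF.
move=> b /andP[Bb ob]; have /designP[/(_ b Bb)] := dB; rewrite inE => /eqP b3 _.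
by rewrite -setDE card_setD1 // b3.
Qed.

(** * Systems compatible with a labelling, split by the labels on a block *)

Section Labelled.

Variables (T : finType) (V : finZmodType) (f : T -> V).
Hypothesis V2 : forall v : V, (v + v = 0)%R.
Local Open Scope ring_scope.

Definition null_triples :=
  [set b : {set T} | (#|b| == 3)%N && (\sum_(x in b) f x == 0)].

Lemma oppV (v : V) : - v = v. Proof. by apply/eqP; rewrite eq_sym -addr_eq0 V2. Qed.

Lemma addV_eq0 (u v : V) : (u + v == 0) = (u == v).
Proof. by rewrite addr_eq0 oppV. Qed.

(* The third point of a null block through the pair [p] must have label [\sum_(x in p) f x]. *)
Definition pair_type (p : {set T}) : {set V} := (\sum_(x in p) f x) |: f @: p.

Lemma pair_type_sub b p :
  b \in null_triples -> p \in pairs T -> p \subset b -> f @: b = pair_type p.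
Proof.
rewrite !inE => /andP[/eqP b3 /eqP b0] /eqP p2 pb.
have [z zp bE] := set3_sub_pair b3 p2 pb.
move: b0; rewrite bE big_setU1 //= => /eqP; rewrite addV_eq0 => /eqP fz.
by rewrite imsetU1 fz.
Qed.

Lemma pair_type2 x y : x != y -> pair_type [set x; y] = [set f x + f y; f x; f y].
Proof. by move=> xy; rewrite /pair_type sum_set2 // imsetU1 imset_set1 setUA. Qed.

(** These are the lines of the projective space of [V] over the field with two elements: the
    two-dimensional subspaces with 0 removed. *)
Definition lines := [set t : {set V} | [&& (#|t| == 3)%N, 0 \notin t & \sum_(v in t) v == 0]].

Lemma linesP t : t \in lines -> exists a b c,
  [/\ t = [set a; b; c], a != b, a != c & b != c] /\
  [/\ a != 0, b != 0, c != 0, a + b = c & a + c = b /\ b + c = a].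
Proof.
rewrite inE => /and3P[t3 t0 /eqP tS].
have [a ta] : exists a, a \in t by apply/card_gt0P; rewrite (eqP t3).
have : #|t :\ a| == 2%N by rewrite card_setD1 // (eqP t3).
case/cards2P => b [c [bc tE]].
have [ba tb] : b != a /\ b \in t by apply/andP; rewrite -in_setD1 tE !inE eqxx.
have [ca tc] : c != a /\ c \in t by apply/andP; rewrite -in_setD1 tE !inE eqxx orbT.
have nz v : v \in t -> v != 0 by apply: contraTneq => ->.
have tE3 : t = [set a; b; c] by rewrite -(setD1K ta) tE setUA.
have ab_c : a + b = c.
  move: tS; rewrite tE3 -setUA big_setU1 /= ?sum_set2 //; last first.
    by rewrite !inE negb_or ![a == _]eq_sym ba.
  by rewrite addrA => /eqP; rewrite addV_eq0 => /eqP.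
exists a, b, c; split; first by rewrite ![a == _]eq_sym.
split; rewrite ?nz //; split; rewrite -ab_c; first by rewrite addrA V2 add0r.
by rewrite addrCA V2 addr0.
Qed.

Lemma card_offdiag (U : finType) (A : {set U}) :
  #|[set xy : U * U | [&& xy.1 \in A, xy.2 \in A & xy.1 != xy.2]]| = (#|A| * #|A|.-1)%N.
Proof.
rewrite -sum1_card (eq_bigl (fun xy : U * U =>
  (xy.1 \in A) && ((xy.2 \in A) && (xy.1 != xy.2)))); last by move=> xy; rewrite inE.
rewrite -(pair_big_dep (fun x => x \in A) (fun x y => (y \in A) && (x != y)) (fun _ _ => 1%N)) /=.
rewrite (eq_bigr (fun=> #|A|.-1)) ?sum_nat_const // => x xA.
rewrite sum1dep_card (cardsD1 x A) xA /=; apply: eq_card => y.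
by rewrite !inE andbC eq_sym.
Qed.

Lemma line_through (a b : V) : a != 0 -> b != 0 -> a != b -> [set a + b; a; b] \in lines.
Proof.
move=> a0 b0 ab; rewrite inE -setUA.
have abN : a + b \notin [set a; b].
  rewrite !inE negb_or -subr_eq0 addrC addKr b0 /=.
  by rewrite -subr_eq0 addrK a0.
rewrite cardsU1 abN cards2 ab big_setU1 //= sum_set2 // V2 eqxx andbT.
by rewrite !inE !negb_or ![0 == _]eq_sym addV_eq0 ab a0.
Qed.

(** Every ordered pair of distinct nonzero vectors lies on one line, and every line contains six
    such pairs. *)
Lemma card_lines : (#|lines| * 6 = (#|V| - 1) * (#|V| - 2))%N.
Proof.
have <- : #|[set ab : V * V | [&& ab.1 \in [set~ 0], ab.2 \in [set~ 0] & ab.1 != ab.2]]| =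
  ((#|V| - 1) * (#|V| - 2))%N.
  by rewrite card_offdiag cardsC1 subn1 subn2.
pose line (ab : V * V) := [set ab.1 + ab.2; ab.1; ab.2].
rewrite -[RHS]sum1_card (partition_big line (mem lines)) /=; last first.
  by move=> [a b]; rewrite inE !in_setC1 => /and3P[a0 b0 ab]; apply: line_through.
rewrite -sum_nat_const; apply: eq_bigr => t tL.
have t3 : #|t| = 3 by move: tL; rewrite inE => /andP[/eqP].
have t0 : 0 \notin t by move: tL; rewrite inE => /and3P[].
have -> : 6%N = (#|t| * #|t|.-1)%N by rewrite t3.
rewrite sum1dep_card -card_offdiag; apply: eq_card => -[a b].
rewrite !inE /=; apply/and3P/andP => [[ta tb ab]|[/and3P[a0 b0 ab] /eqP<-]]; last first.
  by rewrite !inE !eqxx !orbT.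
have a0 : a != 0 by apply: contraTneq ta => ->.
have b0 : b != 0 by apply: contraTneq tb => ->.
split; first by rewrite a0 b0.
(* Any two distinct points of [t] sum to the third, so each of the six ordered pairs spans [t]
   itself. *)
have /linesP[x [y [z [[tE xy xz yz] [_ _ _ xyz [xzy yzx]]]]]] := tL.
have sums := (xyz, xzy, yzx, (addrC y x, addrC z x, addrC z y)).
move: ta tb ab; rewrite /line tE !inE /= => /orP[/orP[]|] /eqP-> /orP[/orP[]|] /eqP->;
  rewrite ?eqxx // => _; rewrite !sums; apply/eqP/setP => v; rewrite !inE;
  by case: (v == x); case: (v == y); case: (v == z).
Qed.

Let Tr_ (t : {set V}) := [set b in null_triples | f @: b == t].
Let Pr_ (t : {set V}) := [set p in pairs T | pair_type p == t].

(** The type of a block with labels 0, [a], [a]: as an image set, it forgets that [a] occurs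
    twice. *)
Definition rays := [set [set 0; a] | a in [set~ (0 : V)]].

(** Labels 0 and 0 give the point type; 0 and [a], or [a] and [a], give a ray; distinct nonzero
    labels give a line. *)
Lemma pair_type_cases p : p \in pairs T ->
  [|| pair_type p == [set 0], pair_type p \in rays | pair_type p \in lines].
Proof.
rewrite inE => /cards2P[x [y [xy ->]]]; rewrite pair_type2 //.
have rayP v : v != 0 -> [set 0; v] \in rays by move=> v0; apply: imset_f; rewrite !inE.
have [<-|xy'] := eqVneq (f x) (f y).
  rewrite V2 -setUA setUid; have [->|/rayP->] := eqVneq (f x) 0; last by rewrite orbT.
  by rewrite setUid !eqxx.
have [x0|x0] := eqVneq (f x) 0.
  by rewrite x0 add0r setUAC setUid setUC rayP ?orbT // -x0 eq_sym.
have [y0|y0] := eqVneq (f y) 0.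
  by rewrite y0 addr0 setUid setUC rayP ?orbT.
by rewrite line_through ?orbT.
Qed.

(** No pair, hence no block, has such a type, and the empty design is the only one. This lets the
    product run over all subsets of [V]. *)
Lemma card_designs_untyped t :
  t != [set 0] -> t \notin rays -> t \notin lines -> #|designs (Tr_ t) (Pr_ t)| = 1%N.
Proof.
move=> t0 tr tl.
have PrE : Pr_ t = set0.
  apply/setP => p; rewrite !inE; apply/negP => /andP[p2 /eqP pt].
  have : p \in pairs T by rewrite inE.
  by move=> /pair_type_cases; rewrite pt (negPf t0) (negPf tr) (negPf tl).
suff -> : Tr_ t = set0 by rewrite PrE card_designs_none.
apply/setP => b; rewrite inE [RHS]inE; apply/negP => /andP[bT /eqP bt].
have [p pb p2] : exists2 p : {set T}, p \subset b & p \in pairs T.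
  move: bT; rewrite inE => /andP[/eqP b3 _].
  have [x bx] : exists x, x \in b by apply/card_gt0P; rewrite b3.
  exists (b :\ x); first exact: subD1set.
  by rewrite inE card_setD1 // b3.
have /setP/(_ p) := PrE; rewrite !inE -(pair_type_sub bT p2 pb) bt eqxx andbT.
by move: p2; rewrite inE => ->.
Qed.

Variable m : nat.
Hypothesis m_gt0 : (0 < m)%N.
Hypothesis fiber0 : #|[set x | f x == 0]| = m.-1.
Hypothesis fiberN0 : forall a, a != 0 -> #|[set x | f x == a]| = m.

(** Inside the fiber of 0 the sum condition is void, so every triple is allowed. *)
Lemma card_designs_fiber0 : #|designs (Tr_ [set 0]) (Pr_ [set 0])| = Psi m.-1.
Proof.
have [|e [e_inj eA eP]] := @exists_enum 'I_m.-1 _ [set x | f x == 0]; first by rewrite card_ord.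
have fe i : f (e i) = 0 by have := eA i; rewrite inE => /eqP.
have preE (s : {set T}) : {in s, forall x, f x = 0} -> e @: (e @^-1: s) = s.
  move=> s0; apply/setP => x; apply/imsetP/idP => [[i]|xs]; first by rewrite inE => ? ->.
  have /eP[i xi] : x \in [set x | f x == 0] by rewrite inE s0.
  by exists i; rewrite // inE -xi.
have im0 (s : {set 'I_m.-1}) : s != set0 -> f @: (e @: s) = [set 0].
  case/set0Pn => i si; apply/setP => v; rewrite !inE.
  apply/imsetP/eqP => [[_ /imsetP[k _ ->] ->]//|->].
  by exists (e i); rewrite ?imset_f.
have sum0 (s : {set 'I_m.-1}) : \sum_(x in e @: s) f x = 0.
  by apply: big1 => _ /imsetP[i _ ->].
rewrite Psi_designs -(card_designs_imset _ _ e_inj); congr #|designs _ _|; apply/setP => s.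
  apply/idP/imsetP => [|[s' s3 ->]].
    rewrite !inE => /andP[/andP[s3 _] /eqP sf].
    have es := preE s; exists (e @^-1: s); last first.
      by rewrite es // => x xs; apply/set1P; rewrite -sf imset_f.
    rewrite inE -(card_imset _ e_inj) es // => x xs.
    by apply/set1P; rewrite -sf imset_f.
  move: s3; rewrite !inE => s3; rewrite card_imset // s3 sum0 eqxx im0 ?eqxx //.
  by rewrite -card_gt0 (eqP s3).
apply/idP/imsetP => [|[s' s2 ->]].
  rewrite !inE => /andP[s2 /eqP sf].
  have s0 : {in s, forall x, f x = 0}.
    by move=> x xs; apply/set1P; rewrite -sf !inE imset_f ?orbT.
  exists (e @^-1: s); last by rewrite preE.
  by rewrite inE -(card_imset _ e_inj) preE.
move: s2; rewrite !inE => s2; rewrite card_imset // s2 /pair_type sum0 im0 ?setUid ?eqxx //=.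
by rewrite -card_gt0 (eqP s2).
Qed.

(** A block joins one point over 0, serving as a colour, to an edge between two points over [a]. The
    [m - 1] colours and [m] vertices are the numbers for a one-factorization, one vertex playing
    [None]. *)
Lemma card_designs_ray a : (m.-1 == 0)%N || odd m.-1 -> a != 0 ->
  #|designs (Tr_ [set 0; a]) (Pr_ [set 0; a])| = Pi m.-1.
Proof.
move=> m_odd a0.
have [|e [e_inj eA eP]] := @exists_enum 'I_m.-1 _ [set x | f x == 0]; first by rewrite card_ord.
have [|ea [ea_inj eaA eaP]] := @exists_enum (option 'I_m.-1) _ [set x | f x == a].
  by rewrite card_option card_ord fiberN0 // prednK.
have fe i : f (e i) = 0 by have := eA i; rewrite inE => /eqP.
have fea i : f (ea i) = a by have := eaA i; rewrite inE => /eqP.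
have eea c o : e c != ea o.
  by apply/eqP => /(congr1 f); rewrite fe fea => /esym/eqP; rewrite (negPf a0).
have in0 x : f x = 0 -> exists c, x = e c by move=> fx; apply/eP; rewrite inE fx.
have ina x : f x = a -> exists o, x = ea o by move=> fx; apply/eaP; rewrite inE fx.
apply: (card_designs_sym_latin m_odd e_inj ea_inj eea) => s; split.
- rewrite !inE => /andP[/andP[/eqP s3 /eqP s0] /eqP sf].
  have /imsetP[x xs fx] : 0 \in f @: s by rewrite sf !inE eqxx.
  have sx2 : #|s :\ x| == 2 by rewrite card_setD1 // s3.
  have /cards2P[y [z [yz sE]]] := sx2.
  have {}sE : s = x |: [set y; z] by rewrite -sE setD1K.
  have xyz : x \notin [set y; z].
    by have := s3; rewrite sE cardsU1 cards2 yz; case: (x \notin _).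
  have fyz : f y = f z.
    apply/eqP; rewrite -addV_eq0 -(sum_set2 _ yz).
    by move: s0; rewrite sE big_setU1 //= -fx add0r => ->.
  have : a \in f @: s by rewrite sf !inE eqxx orbT.
  rewrite sE imsetU1 imsetU1 imset_set1 !inE -fx -fyz orbb (negPf a0) => /eqP fy.
  have [c xc] := in0 x (esym fx); have [o yo] := ina y (esym fy).
  have [o' zo'] := ina z (etrans (esym fyz) (esym fy)).
  exists c, o, o'; split; last by rewrite xc yo zo' setUA.
  by rewrite -(inj_eq ea_inj) -yo -zo'.
- move=> [c [o [o' [oo' ->]]]].
  have eoo' : ea o != ea o' by rewrite (inj_eq ea_inj).
  have cN : e c \notin [set ea o; ea o'] by rewrite !inE negb_or !eea.
  rewrite !inE -setUA cardsU1 cN cards2 eoo' big_setU1 //= sum_set2 // fe !fea V2 addr0.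
  by rewrite !imsetU1 imset_set1 fe !fea setUid !eqxx.
- rewrite !inE => /andP[/cards2P[x [y [xy ->]]]]; rewrite pair_type2 // => /eqP sf.
  have : f x \in [set 0; a] by rewrite -sf !inE eqxx orbT.
  have : f y \in [set 0; a] by rewrite -sf !inE eqxx orbT.
  rewrite !inE => /orP[]/eqP fy /orP[]/eqP fx.
  + have := set22 0 a; rewrite -sf fx fy addr0 !inE (negPf a0) //.
  + have [c ->] := in0 _ fy; have [o ->] := ina _ fx.
    by left; exists c, o; rewrite setUC.
  + have [c ->] := in0 _ fx; have [o ->] := ina _ fy.
    by left; exists c, o.
  have [o xo] := ina _ fx; have [o' yo'] := ina _ fy.
  by right; exists o, o'; rewrite -(inj_eq ea_inj) -xo -yo'.
case=> [[c [o ->]]|[o [o' [oo' ->]]]].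
  rewrite !inE cards2 eea pair_type2 // fe fea add0r.
  by rewrite setUAC setUid setUC !eqxx.
have eoo' : ea o != ea o' by rewrite (inj_eq ea_inj).
by rewrite !inE cards2 eoo' pair_type2 // !fea V2 -setUA setUid !eqxx.
Qed.

(** A block has one point over each point of the line; the three fibers of size [m] serve as rows,
    columns and symbols. *)
Lemma card_designs_line t : t \in lines -> #|designs (Tr_ t) (Pr_ t)| = Lambda m.
Proof.
move=> tL; have [a [b [c [[tE ab ac bc] [a0 b0 c0 abc [acb bca]]]]]] := linesP tL.
have enumP v : v != 0 -> exists e : 'I_m -> T,
    [/\ injective e, forall i, f (e i) = v & forall x, f x = v -> exists i, x = e i].
  move=> v0; have [|e [e_inj eA eP]] := @exists_enum 'I_m _ [set x | f x == v].
    by rewrite card_ord fiberN0.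
  exists e; split=> // [i|x fx]; last by apply/eP; rewrite inE fx.
  by have := eA i; rewrite inE => /eqP.
have [ea [ea_inj fea ina]] := enumP a a0.
have [eb [eb_inj feb inb]] := enumP b b0.
have [ec [ec_inj fec inc]] := enumP c c0.
have eab i k : ea i != eb k by apply: contra_neq ab => /(congr1 f); rewrite fea feb.
have eac i k : ea i != ec k by apply: contra_neq ac => /(congr1 f); rewrite fea fec.
have ebc i k : eb i != ec k by apply: contra_neq bc => /(congr1 f); rewrite feb fec.
apply: (card_designs_latin ea_inj eb_inj ec_inj eab eac ebc) => s; split.
- rewrite !inE => /andP[/andP[/eqP s3 _] /eqP sf].
  have /imsetP[x xs /esym fx] : a \in f @: s by rewrite sf tE !inE eqxx.
  have /imsetP[y ys /esym fy] : b \in f @: s by rewrite sf tE !inE eqxx orbT.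
  have /imsetP[z zs /esym fz] : c \in f @: s by rewrite sf tE !inE eqxx orbT.
  have [i xi] := ina _ fx; have [k yk] := inb _ fy; have [l zl] := inc _ fz.
  exists i, k, l; rewrite -xi -yk -zl; apply/eqP; rewrite eq_sym eqEcard s3.
  rewrite !subUset !sub1set xs ys zs /= xi yk zl -setUA cardsU1 cards2 !inE negb_or.
  by rewrite eab eac ebc.
- move=> [x [y [z ->]]]; rewrite !inE -setUA cardsU1 !inE negb_or eab eac cards2 ebc /=.
  rewrite big_setU1 ?inE ?negb_or ?eab ?eac //= sum_set2 //.
  by rewrite !imsetU1 imset_set1 fea feb fec bca V2 eqxx /= tE setUA.
- rewrite !inE => /andP[/cards2P[x [y [xy ->]]]]; rewrite pair_type2 // => /eqP sf.
  have t0 : 0 \notin t by move: tL; rewrite inE => /and3P[].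
  have fxy : f x != f y.
    by apply: contraNneq t0 => fxy; rewrite -sf !inE fxy V2 eqxx.
  have : f x \in t by rewrite -sf !inE eqxx orbT.
  have : f y \in t by rewrite -sf !inE eqxx orbT.
  rewrite tE !inE => /orP[/orP[]|] /eqP fy /orP[/orP[]|] /eqP fx;
    try by rewrite fx fy eqxx in fxy.
  + have [i ->] := ina _ fy; have [k ->] := inb _ fx.
    by constructor 1; exists i, k; rewrite setUC.
  + have [i ->] := ina _ fy; have [k ->] := inc _ fx.
    by constructor 2; exists i, k; rewrite setUC.
  + have [i ->] := inb _ fy; have [k ->] := ina _ fx.
    by constructor 1; exists k, i.
  + have [i ->] := inb _ fy; have [k ->] := inc _ fx.
    by constructor 3; exists i, k; rewrite setUC.
  + have [i ->] := inc _ fy; have [k ->] := ina _ fx.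
    by constructor 2; exists k, i.
  + have [i ->] := inc _ fy; have [k ->] := inb _ fx.
    by constructor 3; exists k, i.
case=> [] [i [k ->]]; rewrite !inE cards2 ?eab ?eac ?ebc pair_type2 // ?fea ?feb ?fec ?abc ?acb ?bca tE;
  by apply/eqP/setP => v; rewrite !inE; case: (v == a); case: (v == b); case: (v == c).
Qed.

(** Any pair in a null block already determines the type of the block, so the designs factor over
    the types. *)
Lemma card_null_designs :
  #|designs null_triples (pairs T)| =
  (Psi m.-1 * Pi m.-1 ^ #|V|.-1 * Lambda m ^ #|lines|)%N.
Proof.
rewrite (card_designs_prod (I := {set V}) (labT := fun b => f @: b) (labP := pair_type));
  last exact: pair_type_sub.
have [m_odd|/norP[m_n0 m_even]] := boolP ((m.-1 == 0)%N || odd m.-1); last first.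
  (* No Steiner triple system lives on the fiber of 0, so both sides vanish. *)
  by rewrite Psi_even // (bigD1 [set 0]) //= card_designs_fiber0 Psi_even.
have rayP t : t \in rays -> exists2 a, a != 0 & t = [set 0; a].
  by case/imsetP => a; rewrite !inE => a0 ->; exists a.
have card_rays : #|rays| = #|V|.-1.
  rewrite card_in_imset ?cardsC1 // => a b; rewrite !inE => a0 b0 /setP/(_ a).
  by rewrite !inE eqxx orbT (negPf a0) => /esym/eqP.
(* The three conditions exclude one another, since they force [t] to have 1, 2 or 3 elements; at
   most one factor differs from 1. *)
pose N (t : {set V}) := ((if t == [set 0%R] then Psi m.-1 else 1) * (if t \in rays then Pi m.-1 else 1)
  * (if t \in lines then Lambda m else 1))%N.
transitivity (\prod_(t : {set V}) N t)%N.
  apply: eq_bigr => t _; rewrite -/(Tr_ t) -/(Pr_ t) /N.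
  have line3 : t \in lines -> #|t| = 3 by rewrite inE => /andP[/eqP].
  have ray2 : t \in rays -> #|t| = 2.
    by case/rayP => a a0 ->; rewrite cards2 eq_sym a0.
  have [t0|t0] := eqVneq t [set 0].
    have t1 : #|t| = 1%N by rewrite t0 cards1.
    rewrite ifN ?ifN ?muln1; first by rewrite t0 card_designs_fiber0.
      by apply/negP => /line3; rewrite t1.
    by apply/negP => /ray2; rewrite t1.
  have [tR|tR] := boolP (t \in rays).
    rewrite ifN; last by apply/negP => /line3; rewrite ray2.
    by have [a a0 ->] := rayP _ tR; rewrite card_designs_ray // mul1n muln1.
  have [tL|tL] := boolP (t \in lines); first by rewrite card_designs_line // !mul1n.
  by rewrite card_designs_untyped.
rewrite /N !big_split /= -!big_mkcond /= !prod_nat_const card_rays.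
rewrite (_ : #|_| = 1%N) ?expn1 //; exact: card1.
Qed.

End Labelled.

(** * Counting labellings *)

(** If [v] is outside the row space of [G], then the intersection with the span of [v] has rank
    below 1, so adding [v] raises the rank by one. *)
Lemma row_free_col_mx (K : fieldType) j n (v : 'rV[K]_n) (G : 'M[K]_(j, n)) :
  row_free (col_mx v G) = row_free G && ~~ (v <= G)%MS.
Proof.
rewrite /row_free -addsmxE.
have [vG|nvG] := boolP (v <= G)%MS; rewrite ?andbF ?andbT.
  by rewrite (addsmx_idPr vG) ltn_eqF // ltnS rank_leq_row.
have := mxrank_sum_cap v G; have rv : \rank v = 1%N.
  by rewrite rank_rV; case: eqP nvG => // ->; rewrite sub0mx.
suff -> : \rank (v :&: G)%MS = 0%N by rewrite addn0 rv => ->; rewrite eqn_add2l.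
suff lt1 : \rank (v :&: G)%MS < \rank v.
  by apply/eqP; rewrite -leqn0 -ltnS; move: lt1; rewrite [X in _ < X]rv.
rewrite ltn_neqAle mxrankS ?capmxSl // andbT.
apply: contra nvG => /eqP e; have := mxrank_leqif_sup (capmxSl v G).
by case=> _ /esym; rewrite e eqxx => /submx_trans; apply; apply: capmxSr.
Qed.

(** The rows are chosen one at a time, each outside the span of the [s] rows already present. For
    [j] above the rank of [A], the factor with [s] equal to that rank is 0. *)
Lemma card_row_free_sub (K : finFieldType) p n (A : 'M[K]_(p, n)) j :
  #|[set G : 'M[K]_(j, n) | row_free G && (G <= A)%MS]| =
  \prod_(s < j) (#|K| ^ \rank A - #|K| ^ s).
Proof.
elim: j => [|j IHj].
  rewrite big_ord0 (_ : [set G | _] = setT) ?cardsT ?card_mx ?mul0n ?expn0 //.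
  by apply/setP => G; rewrite !inE flatmx0 /row_free mxrank0 sub0mx.
rewrite big_ord_recr /= -{}IHj.
transitivity (\sum_(G : 'M[K]_(j, n) | row_free G && (G <= A)%MS)
    \sum_(v : 'rV[K]_n | ((v <= A)%MS) && ~~ (v <= G)%MS) 1)%N.
  rewrite pair_big_dep /= -sum1_card (reindex (fun Gv : 'M[K]_(j, n) * 'rV[K]_n =>
    (col_mx Gv.2 Gv.1 : 'M_(1 + j, n)))) /=.
    apply: eq_bigl => -[G v]; rewrite inE /= row_free_col_mx (col_mx_sub v G A).
    by case: (row_free G); case: (_ <= A)%MS; case: (_ <= A)%MS; case: (v <= G)%MS.
  exists (fun M : 'M[K]_(1 + j, n) => (dsubmx M, usubmx M)) => [[G v] _|M _] /=.
    by rewrite col_mxKd col_mxKu.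
  by rewrite vsubmxK.
rewrite cardsE -sum_nat_const; apply: eq_bigr => G /andP[/eqP Gfree sGA].
rewrite sum1dep_card -[X in _ = _ - #|K| ^ X]Gfree -!card_rowg.
have sGA' : rowg G \subset rowg A.
  by apply/subsetP => v; rewrite !mem_rowg => /submx_trans; apply.
rewrite -(setIidPr sGA') -cardsD; apply: eq_card => v.
by rewrite inE in_setD !mem_rowg andbC.
Qed.

Lemma card_right_kernel (K : finFieldType) p n (A : 'M[K]_(p, n)) j :
  #|[set F : 'M[K]_(n, j) | (A *m F == 0)%R && (\rank F == j)]| =
  \prod_(s < j) (#|K| ^ (n - \rank A) - #|K| ^ s).
Proof.
rewrite -(mxrank_tr A) -mxrank_ker -card_row_free_sub -(card_imset _ (@trmx_inj K n j)).
apply: eq_card => G; rewrite inE; apply/imsetP/andP => [[F]|[Gfree /sub_kermxP GA]].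
  rewrite inE => /andP[/eqP AF Fj] ->; rewrite /row_free mxrank_tr; split=> //.
  by apply/sub_kermxP; rewrite -trmx_mul AF trmx0.
exists (G^T)%R; rewrite ?trmxK // inE mxrank_tr -[\rank G == j]/(row_free G) Gfree andbT.
by apply/eqP/trmx_inj; rewrite trmx_mul trmxK GA trmx0.
Qed.

(** The multinomial coefficient, without division. The induction removes the first entry [v],
    lowering [c v] by one, and splits the leading factor of the factorial as the sum of the
    [c v]. *)
Lemma card_tuples_fibers (V : finType) n (c : V -> nat) : \sum_v c v = n ->
  #|[set t : n.-tuple V | [forall v, count_mem v t == c v]]| * \prod_v (c v)`! = n`!.
Proof.
elim: n c => [|n IHn] c sum_c.
  have c0 v : c v = 0 by apply/eqP; rewrite -leqn0 -sum_c (bigD1 v) //= leq_addr.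
  rewrite big1 => [|v _]; last by rewrite c0.
  rewrite muln1 (_ : [set t | _] = setT) ?cardsT ?card_tuple //.
  by apply/setP => t; rewrite !inE tuple0; apply/forallP => v; rewrite c0.
pose c' v u := c u - (v == u).
transitivity ((\sum_v #|[set t : n.-tuple V | [forall u, (v == u) + count_mem u t == c u]]|)
    * \prod_v (c v)`!).
  congr muln; rewrite -sum1_card (reindex (fun vt : V * n.-tuple V => [tuple of vt.1 :: vt.2])) /=.
    rewrite (eq_bigl (fun vt : V * n.-tuple V =>
      [forall u, (vt.1 == u) + count_mem u vt.2 == c u])); last first.
      by move=> [v t]; rewrite inE.
    rewrite -(pair_big_dep xpredT (fun v (t : n.-tuple V) =>
      [forall u, (v == u) + count_mem u t == c u]) (fun _ _ => 1)) /=.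
    by apply: eq_bigr => v _; rewrite sum1dep_card.
  exists (fun t : n.+1.-tuple V => (thead t, [tuple of behead t])) => [[v t] _|t _] /=.
    by rewrite theadE; congr pair; apply: val_inj.
  by rewrite -tuple_eta.
rewrite factS -{1}sum_c !big_distrl /=; apply: eq_bigr => v _.
have [cv0|cv_gt0] := posnP (c v).
  rewrite cv0 mul0n (_ : [set t | _] = set0) ?cards0 //.
  by apply/setP => t; rewrite !inE; apply/negP => /forallP/(_ v); rewrite eqxx cv0.
have c'v : c v = (c' v v).+1 by rewrite /c' eqxx subn1 prednK.
have c'N u : u != v -> c' v u = c u by rewrite /c' eq_sym => /negPf->; rewrite subn0.
rewrite -(IHn (c' v)); last first.
  apply: succn_inj; rewrite -sum_c (bigD1 v) //= [RHS](bigD1 v) //= c'v addSn.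
  by congr (_ + _).+1; apply: eq_bigr => u; apply: c'N.
rewrite mulnCA; congr muln.
  apply: eq_card => t; rewrite !inE; apply: eq_forallb => u.
  have [<-|uv] := eqVneq v u; first by rewrite c'v.
  by rewrite c'N // eq_sym.
rewrite (bigD1 v) //= c'v factS -mulnA; congr muln.
rewrite [RHS](bigD1 v) //=; congr muln.
by apply: eq_bigr => u /c'N->.
Qed.

Lemma sum_fibers (T V : finType) (f : T -> V) : \sum_v #|[set x | f x == v]| = #|T|.
Proof.
rewrite -sum1_card (partition_big f xpredT) //=; apply: eq_bigr => v _.
by rewrite sum1dep_card.
Qed.

(** * Balanced labellings and words of the dual code *)

Section Balanced.

Variables (n j : nat).
Implicit Types (F : 'M['F_2]_(n, j)) (B : {set {set 'I_n}}).
Local Open Scope ring_scope.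

Lemma F2_addvv (v : 'rV['F_2]_j) : v + v = 0.
Proof. by rewrite -mulr2n -scaler_nat (_ : 2%:R = 0 :> 'F_2) ?scale0r //; apply/val_inj. Qed.

(** One more point labelled 0 would make all fibers have size [m]. *)
Definition balanced (m : nat) F : bool :=
  [forall a, #|[set x | row x F == a]| == (if a == 0%R then m.-1 else m)].

Lemma card_balanced m : (0 < m)%N -> n = (2 ^ j * m).-1 ->
  (#|[set F | balanced m F]| * (m.-1`! * m`! ^ (2 ^ j).-1))%N = n`!.
Proof.
move=> m_gt0 nE; pose c (a : 'rV['F_2]_j) := if a == 0%R then m.-1 else m.
have cardV : #|{: 'rV['F_2]_j}| = (2 ^ j)%N by rewrite card_mx card_Fp // mul1n.
have cardVN0 : #|[pred a : 'rV['F_2]_j | a != 0]| = (2 ^ j).-1 by rewrite cardC1 cardV.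
have sum_c : (\sum_a c a)%N = n.
  rewrite (bigD1 0) //= /c eqxx (eq_bigr (fun=> m)) => [|a /negPf->//].
  rewrite sum_nat_const cardVN0 nE.
  by have := expn_gt0 2 j; case: (2 ^ j)%N => // q _; case: m m_gt0 {c nE} => // m _;
    rewrite !mulSn.
rewrite -(card_tuples_fibers sum_c); congr muln; last first.
  rewrite (bigD1 0) //= /c eqxx; congr muln.
  by rewrite (eq_bigr (fun=> m`!)) => [|a /negPf->//]; rewrite prod_nat_const cardVN0.
pose mx (t : n.-tuple 'rV['F_2]_j) := \matrix_i tnth t i.
have mx_inj : injective mx.
  by move=> t t' e; apply: eq_from_tnth => i; rewrite -(rowK (tnth t)) -/(mx t) e rowK.
rewrite -(card_imset _ mx_inj); apply: eq_card => F.
have mxE (F' : 'M_(n, j)) : mx [tuple row i F' | i < n] = F'.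
  by apply/row_matrixP => i; rewrite rowK tnth_mktuple.
have countE v t : count_mem v (t : n.-tuple 'rV['F_2]_j) = #|[set x | row x (mx t) == v]|.
  rewrite -sum1_count big_tuple sum1dep_card.
  by apply: eq_card => i; rewrite !inE rowK.
rewrite inE; apply/idP/imsetP => [bF|[t]].
  exists [tuple row i F | i < n]; last by rewrite mxE.
  rewrite inE; apply/forallP => v; rewrite countE mxE; exact: (forallP bF).
by rewrite inE => /forallP tc ->; apply/forallP => v; rewrite -countE; apply: tc.
Qed.

(** Every nonzero vector, in particular every unit vector, occurs as a row of [F]. *)
Lemma balanced_rank m F : (0 < m)%N -> balanced m F -> \rank F = j.
Proof.
move=> m_gt0 /forallP bF; apply/eqP; rewrite -[_ == j]/(row_full F) -sub1mx.
apply/row_subP => i; have [->|v0] := eqVneq (row i 1%:M : 'rV['F_2]_j) 0.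
  exact: sub0mx.
have := bF (row i 1%:M); rewrite (negPf v0) => /eqP fib.
have /card_gt0P[x] : (0 < #|[set x | row x F == row i 1%:M]|)%N by rewrite fib.
by rewrite inE => /eqP <-; apply: row_sub.
Qed.

Lemma inc_mx_mul B F :
  (inc_mx B *m F == 0) = [forall b in B, \sum_(x in b) row x F == 0].
Proof.
have rowE i : row i (inc_mx B *m F) = \sum_(x in @enum_val _ (mem B) i) row x F.
  rewrite row_mul mulmx_sum_row [RHS]big_mkcond; apply: eq_bigr => x _.
  by rewrite !mxE; case: (x \in _); rewrite ?scale1r ?scale0r.
apply/eqP/forall_inP => [incF b bB|sumF].
  by have := rowE (enum_rank_in bB b); rewrite enum_rankK_in // incF row0 => <-.
by apply/row_matrixP => i; rewrite rowE row0; apply/eqP/sumF/enum_valP.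
Qed.

(** The link between the two ways of counting: kernel matrices for a fixed [B], and null designs for
    a fixed [F]. *)
Lemma is_STS_inc_mx B F :
  (is_STS B && (inc_mx B *m F == 0)) =
  (B \in designs (null_triples (fun x => row x F)) (pairs 'I_n)).
Proof.
rewrite is_STS_design inc_mx_mul inE /design -andbA andbCA andbC; congr andb.
apply/andP/subsetP => [[/subsetP B3 /forall_inP B0] b bB|sub].
  by have := B3 b bB; rewrite !inE => ->; apply: B0.
by split; [apply/subsetP|apply/forall_inP] => b /sub; rewrite !inE => /andP[].
Qed.

(** Nonempty fibers over nonzero labels have one point more than the fiber of 0. No fiber over a
    nonzero label is empty, because the labels together with 0 form a subspace, which full rank
    makes everything. *)
Lemma STS_balanced B F : is_STS B -> inc_mx B *m F = 0 -> \rank F = j ->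
  exists2 m, n.+1 = (2 ^ j * m.+1)%N & balanced m.+1 F.
Proof.
move=> sB incF rF; pose f x := row x F; pose fib a := [set x | f x == a].
have : B \in designs (null_triples f) (pairs 'I_n) by rewrite -is_STS_inc_mx sB incF eqxx.
rewrite inE => dB; have /designP[sub cov] := dB.
have blockE x b : b \in B -> x \in b -> exists y z,
    [/\ y != z, x \notin [set y; z], b = x |: [set y; z] & f y + f z = f x].
  move=> /sub; rewrite inE => /andP[/eqP b3 /eqP b0] xb.
  have /cards2P[y [z [yz bE]]] : #|b :\ x| == 2 by rewrite card_setD1 // b3.
  have xyz : x \notin [set y; z] by rewrite -bE !inE eqxx.
  exists y, z; split=> //; first by rewrite -bE setD1K.
  apply/eqP; rewrite -(addV_eq0 F2_addvv) addrC -(sum_set2 _ yz) -big_setU1 // -bE setD1K //.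
  exact/eqP.
(* For [x] over [a], both [fib a :\ x] and [fib 0] are counted along the blocks through [x]. *)
have fib_size a : a != 0 -> fib a != set0 -> #|fib a| = #|fib 0|.+1.
  move=> a0 /set0Pn[x xa]; have /eqP fx : f x == a by rewrite inE in xa.
  rewrite (cardsD1 x) xa add1n; congr _.+1.
  have x0 : x \notin fib 0 by rewrite inE fx.
  rewrite (sum_block_meets dB x0) (sum_block_meets dB (negbT (setD11 x _))).
  apply: eq_bigr => b /andP[bB xb].
  have [y [z [yz xyz -> fyz]]] := blockE x b bB xb.
  have card_part (S : {set 'I_n}) : x \notin S ->
      #|(x |: [set y; z]) :&: S| = ((y \in S) + (z \in S))%N.
    move=> xS; rewrite setIUl (_ : [set x] :&: S = set0) ?set0U; last first.
      by apply/setP => t; rewrite !inE; case: eqP => // ->; rewrite (negPf xS).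
    rewrite setIUl cardsU (_ : _ :&: _ :&: _ = set0) ?cards0 ?subn0; last first.
      apply/setP => t; rewrite !inE; case: (t =P y) => //= ->.
      by rewrite (negPf yz) andbF.
    congr addn.
      have [yS|yS] := boolP (y \in S); first by rewrite (setIidPl _) ?sub1set ?cards1.
      by apply: eq_card0 => t; rewrite !inE; case: eqP => // ->; rewrite (negPf yS).
    have [zS|zS] := boolP (z \in S); first by rewrite (setIidPl _) ?sub1set ?cards1.
    by apply: eq_card0 => t; rewrite !inE; case: eqP => // ->; rewrite (negPf zS).
  rewrite !card_part ?setD11 //; rewrite !inE addnC.
  move: xyz; rewrite !inE negb_or ![x == _]eq_sym => /andP[-> ->] /=.
  (* The summands match crosswise: as [f y + f z = a], one of [y], [z] lies over [a] exactly when
     the other lies over 0. *)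
  rewrite fx in fyz; congr (nat_of_bool _ + nat_of_bool _)%N.
    by rewrite -(addV_eq0 F2_addvv) -fyz addrCA F2_addvv addr0.
  by rewrite -(addV_eq0 F2_addvv) -fyz addrA F2_addvv add0r.
have im_add u v : (u == 0) || (fib u != set0) -> (v == 0) || (fib v != set0) ->
    (u + v == 0) || (fib (u + v) != set0).
  move=> /predU1P[->|u1]; first by rewrite add0r.
  move=> /predU1P[->|v1]; first by rewrite addr0 u1 orbT.
  have [->|uv] := eqVneq u v; first by rewrite F2_addvv eqxx.
  have /set0Pn[x] := u1; have /set0Pn[y] := v1; rewrite !inE => /eqP fy /eqP fx.
  have xy : x != y by apply: contra_neq uv => xy; rewrite -fx -fy xy.
  have [|b bB [xyb _]] := cov [set x; y]; first by rewrite inE cards2 xy.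
  move: xyb; rewrite subUset !sub1set => /andP[xb yb].
  have := sub b bB; rewrite inE => /andP[/eqP b3 /eqP b0].
  have xyb : [set x; y] \subset b by rewrite subUset !sub1set xb yb.
  have [|z zxy bE] := set3_sub_pair b3 _ xyb; first by rewrite cards2 xy.
  apply/orP; right; apply/set0Pn; exists z; rewrite inE -(addV_eq0 F2_addvv) -fx -fy.
  by rewrite -(sum_set2 _ xy) -big_setU1 // -bE b0.
have onto a : (a == 0) || (fib a != set0).
  have /submxP[u ->] : (a <= F)%MS by apply: submx_full; rewrite /row_full rF.
  rewrite mulmx_sum_row; elim/big_ind: _ => [||x _]; rewrite ?eqxx //.
  have [->|ux] := eqVneq (u 0 x) 0; first by rewrite scale0r eqxx.
  have -> : u 0 x = 1.
    by move: ux; case: (u 0 x) => -[|[|k]] //= lt_k _; apply: val_inj.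
  by rewrite scale1r; apply/orP; right; apply/set0Pn; exists x; rewrite inE.
exists #|fib 0|; last first.
  apply/forallP => a; case: (eqVneq a 0) => [->|a0] /=; first exact: eqxx.
  by apply/eqP/fib_size => //; have := onto a; rewrite (negPf a0).
rewrite -[n in LHS]card_ord -(sum_fibers f) (bigD1 0) //=.
rewrite (eq_bigr (fun=> #|fib 0|.+1)) => [|a a0]; last first.
  by apply: fib_size => //; have := onto a; rewrite (negPf a0).
rewrite sum_nat_const cardC1 card_mx card_Fp // mul1n -addSn -mulSn prednK //.
by rewrite expn_gt0.
Qed.

End Balanced.

Import Num.Theory.
Local Open Scope ring_scope.

(** * Inversion *)

(** The 2-analogue of the factorial: [qfact n / (qfact l * qfact (n - l))] is the Gaussian binomial
    coefficient at 2. *)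
Definition qfact (n : nat) : rat := \prod_(1 <= s < n.+1) ((2 ^ s)%N%:R - 1).

Lemma qfactS n : qfact n.+1 = qfact n * ((2 ^ n.+1)%N%:R - 1).
Proof. by rewrite /qfact big_nat_recr. Qed.

Lemma pow2_sub1_neq0 n : (2 ^ n.+1)%N%:R - 1 != 0 :> rat.
Proof.
rewrite subr_eq0 -[1]/(1%N%:R) eqr_nat.
by rewrite -[X in _ == X](expn0 2) eqn_exp2l.
Qed.

Lemma qfact_neq0 n : qfact n != 0.
Proof.
elim: n => [|n IHn]; first by rewrite /qfact big_geq ?oner_neq0.
by rewrite qfactS mulf_neq0 ?pow2_sub1_neq0.
Qed.

Lemma mu2S l : mu2 l.+1 = - (2 ^ l)%N%:R * mu2 l.
Proof. by rewrite /mu2 binS bin1 addnC expnD natrM exprS; ring. Qed.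

(* Since [2^e - 1 = (2^l - 1) + 2^l (2^(e-l) - 1)], multiplying the sum by
   [2^e - 1] makes it telescope. *)
Lemma sum_mu2_qfact e :
  \sum_(l < e.+1) mu2 l / (qfact l * qfact (e - l)) = (e == 0)%:R :> rat.
Proof.
case: e => [|e].
  by rewrite big_ord1 /mu2 /qfact subnn !big_geq // expr0 bin0n !mul1r !divr1.
apply: (mulfI (pow2_sub1_neq0 e)); rewrite mulr0 mulr_sumr.
(* The [l]-th term becomes [A l - A (l - 1)]; [X] shifts the index so that nothing is subtracted at
   [l = 0], and the last [A] vanishes through its factor [2 ^ 0 - 1]. *)
pose A l := mu2 l * (2 ^ l)%N%:R * ((2 ^ (e.+1 - l))%N%:R - 1) / (qfact l * qfact (e.+1 - l)).
pose X l : rat := if l is l'.+1 then A l' else 0.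
transitivity (\sum_(0 <= l < e.+2) (X l.+1 - X l)).
  rewrite big_mkord; apply: eq_bigr => -[l /= le_l] _.
  have -> : (2 ^ e.+1)%N%:R - 1 = (2 ^ l)%N%:R * ((2 ^ (e.+1 - l))%N%:R - 1) + ((2 ^ l)%N%:R - 1) :> rat.
    by rewrite mulrBr -natrM -expnD subnKC // mulr1 addrA subrK.
  rewrite mulrDl; congr (_ + _).
    by rewrite /= /A mulrA; congr (_ / _); ring.
  case: l le_l => [|l] le_l; first by rewrite subrr mul0r oppr0.
  have le_le : (l <= e)%N by [].
  rewrite /= /A mu2S qfactS subSS subSn // qfactS.
  have := (qfact_neq0 l, qfact_neq0 (e - l), pow2_sub1_neq0 l, pow2_sub1_neq0 (e - l)).
  move: ((2 ^ l.+1)%N%:R - 1 : rat) ((2 ^ (e - l).+1)%N%:R - 1 : rat).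
  move: (qfact l) (qfact (e - l)) (mu2 l) ((2 ^ l)%N%:R : rat) => a b c d x y [[[a0 b0] x0] y0].
  by field; rewrite ?a0 ?b0 ?x0 ?y0.
by rewrite telescope_sumr //= /A subnn subrr mulr0 mul0r subr0.
Qed.

(** Each factor is [2 ^ s] times [2 ^ (d - s) - 1]; the powers of 2 collect into ['C(j, 2)], and
    [qfact (d - j)] completes the rest to [qfact d]. *)
Lemma prod_pow2_qfact j d : (j <= d)%N ->
  (\prod_(s < j) (2 ^ d - 2 ^ s))%N%:R * qfact (d - j) = (2 ^ 'C(j, 2))%N%:R * qfact d :> rat.
Proof.
elim: j => [|j IHj] lt_jd; first by rewrite big_ord0 subn0 !mul1r.
have IH := IHj (ltnW lt_jd).
have -> : ('C(j.+1, 2) = j + 'C(j, 2))%N by rewrite binS bin1 addnC.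
rewrite expnD natrM -[RHS]mulrA -IH big_ord_recr /= natrM.
have -> : (d - j = (d - j.+1).+1)%N by rewrite -subSn.
have le2 : (2 ^ j <= 2 ^ d)%N by rewrite leq_exp2l // ltnW.
rewrite (qfactS (d - j.+1)) (natrB _ le2).
have -> : (2 ^ d = 2 ^ j * 2 ^ (d - j.+1).+1)%N by rewrite -expnD -subSn // subSS subnKC // ltnW.
by rewrite natrM; ring.
Qed.

(** The inversion: it picks out dual dimension [d = i] from the numbers of rank-[j] labellings of a
    system whose dual code has dimension [d]. *)
Lemma sum_mu2_prod i d k : (d <= k)%N ->
  \sum_(i <= j < k.+1) mu2 (j - i) * (\prod_(s < j) (2 ^ d - 2 ^ s))%N%:R
    / ((2 ^ 'C(j, 2))%N%:R * qfact i * qfact (j - i)) = (d == i)%:R :> rat.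
Proof.
move=> le_dk.
have prod0 j : (d < j)%N -> (\prod_(s < j) (2 ^ d - 2 ^ s))%N = 0%N.
  by move=> lt_dj; rewrite (bigD1 (Ordinal lt_dj)) //= subnn.
have [lt_di|le_id] := ltnP d i.
  rewrite ltn_eqF // big_nat big1 // => j /andP[le_ij _].
  by rewrite prod0 ?mulr0 ?mul0r // (leq_trans lt_di).
(* Terms with [j > d] vanish through the factor [s = d]; with [j = i + l] the others form the
   alternating sum for [e = d - i]. *)
rewrite (big_cat_nat _ (n := d.+1)) //=; last exact: leqW.
rewrite [X in _ + X]big_nat [X in _ + X]big1 ?addr0 => [|j /andP[lt_dj _]]; last first.
  by rewrite prod0 // mulr0 mul0r.
transitivity (qfact d / qfact i * \sum_(l < (d - i).+1) mu2 l / (qfact l * qfact (d - i - l))).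
  rewrite -{1}[i]add0n big_addn (subSn le_id) big_mkord mulr_sumr.
  apply: eq_bigr => -[l /= lt_l] _; rewrite addnK.
  have le_lid : (l + i <= d)%N by move: lt_l; rewrite ltnS leq_subRL // addnC.
  have := prod_pow2_qfact le_lid; rewrite addnC subnDA.
  have : ((2 ^ 'C(i + l, 2))%N%:R : rat) != 0 by rewrite pnatr_eq0 -lt0n expn_gt0.
  have := (qfact_neq0 i, qfact_neq0 l, qfact_neq0 (d - i - l)).
  move: ((_)%:R : rat) ((2 ^ _)%N%:R : rat) (qfact i) (qfact l) (qfact (d - i - l)) (qfact d)
    (mu2 l).
  move=> p c a b e x y [[a0 b0] e0] c0 pe.
  apply: (mulIf e0); rewrite mulrAC -[y * p * e]mulrA pe.
  by field; rewrite ?a0 ?b0 ?e0 ?c0.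
rewrite sum_mu2_qfact subn_eq0.
have [->|d_i] := eqVneq d i; first by rewrite leqnn mulr1 divff ?qfact_neq0.
by rewrite leqNgt ltn_neqAle eq_sym d_i le_id mulr0.
Qed.

(** * The double count and the number of systems of given rank *)

Lemma card_null_designs_balanced n j m (F : 'M['F_2]_(n, j)) : (0 < m)%N -> balanced m F ->
  #|designs (null_triples (fun x => row x F)) (pairs 'I_n)| =
  (Psi m.-1 * Pi m.-1 ^ (2 ^ j).-1 * Lambda m ^ (((2 ^ j - 1) * (2 ^ j - 2)) %/ 6))%N.
Proof.
move=> m_gt0 /forallP bF.
have cardV : #|{: 'rV['F_2]_j}| = (2 ^ j)%N by rewrite card_mx card_Fp // mul1n.
rewrite (card_null_designs (@F2_addvv j) m_gt0); first 1 last.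
- by rewrite (eqP (bF 0)) eqxx.
- by move=> a a0; rewrite (eqP (bF a)) (negPf a0).
by rewrite cardV -cardV -(card_lines (@F2_addvv j)) mulnK.
Qed.

Lemma sum_STS_prod n j m : (0 < m)%N -> n.+1 = (2 ^ j * m)%N ->
  (\sum_(B : {set {set 'I_n}} | is_STS B) \prod_(s < j) (2 ^ (n - rank2 B) - 2 ^ s))%N =
  (#|[set F : 'M['F_2]_(n, j) | balanced m F]| *
   (Psi m.-1 * Pi m.-1 ^ (2 ^ j).-1 * Lambda m ^ (((2 ^ j - 1) * (2 ^ j - 2)) %/ 6)))%N.
Proof.
move=> m_gt0 nE.
transitivity (\sum_(B : {set {set 'I_n}} | is_STS B)
    \sum_(F : 'M['F_2]_(n, j) | (inc_mx B *m F == 0%R) && (\rank F == j)) 1)%N.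
  apply: eq_bigr => B _; rewrite sum1dep_card card_right_kernel card_Fp //.
rewrite (exchange_big_dep (fun F : 'M_(n, j) => \rank F == j)) /=; last by move=> B F _ /andP[].
rewrite -sum_nat_const (bigID (balanced m)) /= [X in (_ + X)%N]big1 ?addn0.
  apply: eq_big => [F|F /andP[rF bF]].
    rewrite inE andbC; case bF: (balanced m F) => //=.
    by rewrite (balanced_rank m_gt0 bF) eqxx.
  rewrite -(card_null_designs_balanced m_gt0 bF) -sum1_card; apply: eq_bigl => B.
  by rewrite rF andbT is_STS_inc_mx.
(* An unbalanced [F] of rank [j] has no compatible system: one would make [F] balanced for some
   [m'.+1], and comparing [n.+1] in both forms gives [m = m'.+1]. *)
move=> F /andP[rF /negP nbF]; apply: big1 => B /and3P[sB /eqP incF _]; case: nbF.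
have [m' nE' bF] := STS_balanced sB incF (eqP rF).
suff -> : m = m'.+1 by [].
by apply/eqP; rewrite -(eqn_pmul2l (expn_gt0 2 j)) -nE -nE'.
Qed.

(** A basis of the whole dual code, taken as the columns of [F], is a labelling to which
    [STS_balanced] applies, so [2 ^ d] divides [n.+1]. *)
Lemma STS_dual_dim n (B : {set {set 'I_n}}) : is_STS B -> (n - rank2 B <= logn 2 n.+1)%N.
Proof.
move=> sB; set d := (n - rank2 B)%N.
have : (0 < #|[set F : 'M['F_2]_(n, d) | (inc_mx B *m F == 0)%R && (\rank F == d)]|)%N.
  rewrite card_right_kernel card_Fp // prodn_gt0 // => s.
  by rewrite subn_gt0 ltn_exp2l.
case/card_gt0P => F; rewrite inE => /andP[/eqP incF /eqP rF].
have [m nE _] := STS_balanced sB incF rF.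
by rewrite -pfactor_dvdn // nE dvdn_mulr.
Qed.

(** The factorials of [w / 2 ^ i] cancel between the two [Gammadot], and the correcting factor
    removes the remaining dependence on [i]. *)
Lemma Gammadot_mul w i j : (0 < w)%N -> (i <= j)%N -> (j <= logn 2 w)%N ->
  Gammadot w 0 i * Gammadot w i j * ((2 ^ 'C(j, 2))%N%:R * qfact i * qfact (j - i)) =
  #|[set F : 'M['F_2]_(w.-1, j) | balanced (w %/ 2 ^ j) F]|%:R.
Proof.
move=> w_gt0 le_ij le_jk; set m := (w %/ 2 ^ j)%N.
have wE : w = (2 ^ j * m)%N by rewrite mulnC divnK // pfactor_dvdn.
have m_gt0 : (0 < m)%N by move: w_gt0; rewrite wE muln_gt0 => /andP[].
(* Multiplying by [w = 2 ^ j * m] turns the factorial of [w - 1] into that of [w], while the factor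
   [m] completes the short fiber. *)
have cardF : (#|[set F : 'M['F_2]_(w.-1, j) | balanced m F]| * (2 ^ j * m`! ^ (2 ^ j)) = w`!)%N.
  rewrite -[in RHS](prednK w_gt0) factS prednK // -(card_balanced (n := w.-1) (j := j) m_gt0);
    last by rewrite -wE.
  rewrite [RHS]mulnCA; congr muln; rewrite [w in RHS]wE.
  have -> : (m`! ^ (2 ^ j) = m * m.-1`! * m`! ^ (2 ^ j).-1)%N.
    have fE : m`! = (m * m.-1`!)%N by rewrite -{1}(prednK m_gt0) factS prednK.
    by rewrite -fE -expnS prednK ?expn_gt0.
  by rewrite !mulnA.
have nz q : (0 < q)%N -> (q%:R : rat) != 0 by move=> q_gt0; rewrite pnatr_eq0 -lt0n.
(* Both exponents equal [j * (j + 1) / 2]; parity shows that the halvings are exact. *)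
have expE : (2 ^ j * 2 ^ 'C(j, 2) = 2 ^ ((i * (i + 1)) %/ 2) * 2 ^ (((j - i) * (j + i + 1)) %/ 2))%N.
  have half q : ~~ odd q -> (q %/ 2 * 2 = q)%N by move=> q_even; rewrite divnK // dvdn2.
  have tri q : (q * 2 + 'C(q, 2) * 2 = q * (q + 1))%N.
    by elim: q => // q IHq; rewrite binS bin1; lia.
  rewrite -!expnD; congr (2 ^ _)%N; apply/eqP; rewrite -(eqn_pmul2r (isT : 0 < 2)%N).
  rewrite !mulnDl tri !half; first by apply/eqP; nia.
    by rewrite oddM oddB // !oddD; case: (odd i); case: (odd j).
  by rewrite oddM oddD; case: (odd i).
rewrite /Gammadot -/(qfact (j - i)) subn0 -/(qfact i) expn0 divn1 expn1 addn0.
rewrite -/m.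
apply: (mulIf (nz (2 ^ j * m`! ^ (2 ^ j))%N _)); first by rewrite muln_gt0 !expn_gt0 fact_gt0.
rewrite -[RHS]natrM cardF !natrM.
have expER := congr1 (fun q => q%:R : rat) expE; rewrite !natrM in expER.
have nz2 q : (2 ^ q)%N%:R != 0 :> rat by rewrite nz ?expn_gt0.
have nzf q r : (q`! ^ r)%N%:R != 0 :> rat by rewrite nz // expn_gt0 fact_gt0.
have := (qfact_neq0 i, qfact_neq0 (j - i), nz2 ((i * (i + 1)) %/ 2)%N,
  nz2 (((j - i) * (j + i + 1)) %/ 2)%N, nzf m (2 ^ j)%N, nzf (w %/ 2 ^ i)%N (2 ^ i)%N).
move: expER.
move: (w`!%:R : rat) ((2 ^ j)%N%:R : rat) ((2 ^ 'C(j, 2))%N%:R : rat) (qfact i) (qfact (j - i))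
  ((2 ^ ((i * (i + 1)) %/ 2))%N%:R : rat) ((2 ^ (((j - i) * (j + i + 1)) %/ 2))%N%:R : rat)
  ((m`! ^ (2 ^ j))%N%:R : rat) (((w %/ 2 ^ i)`! ^ (2 ^ i))%N%:R : rat).
move=> x J C p q a b M I JC [[[[[p0 q0] a0] b0] M0] I0].
transitivity (J * C / (a * b) * x); first by field; rewrite ?p0 ?q0 ?a0 ?b0 ?M0 ?I0.
by rewrite JC divff ?mul1r // mulf_neq0.
Qed.

Theorem theorem2 (w i : nat) :
  ((w - 1) %% 6 == 1)%N || ((w - 1) %% 6 == 3)%N ->
  (i <= logn 2 w)%N ->
  (num_STS_rank (w - 1) (w - i - 1))%:R =
    Gammadot w 0 i *
    \sum_(i <= j < (logn 2 w).+1)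
       Gammadot w i j * mu2 (j - i) * (Phidot w j)%:R :> rat.
Proof.
case: w => [//|n] _; rewrite subSS subn0 => le_ik; set k := logn 2 n.+1 in le_ik *.
(* From [i <= k < 2 ^ k <= n.+1], so the rank [n - i] is not truncated. *)
have le_in : (i <= n)%N.
  rewrite -ltnS (leq_ltn_trans le_ik) // (leq_trans (ltn_expl k (ltnSn 1))) //.
  by rewrite dvdn_leq // pfactor_dvdn.
have -> : (n.+1 - i - 1 = n - i)%N by rewrite subSn // subn1.
transitivity (\sum_(B : {set {set 'I_n}} | is_STS B) ((n - rank2 B)%N == i)%:R : rat).
  rewrite /num_STS_rank -sum1dep_card natr_sum big_mkcondr /=; apply: eq_bigr => B _.
  have le_rn : (rank2 B <= n)%N by apply: rank_leq_col.
  have -> : (rank2 B == n - i)%N = (n - rank2 B == i)%N.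
    by apply/eqP/eqP => [->|<-]; rewrite subKn.
  by case: eqP.
(* The indicator of dual dimension [i] is expanded for each system; after exchanging the sums, each
   [j] contributes one double count. *)
transitivity (\sum_(B : {set {set 'I_n}} | is_STS B) \sum_(i <= j < k.+1)
    mu2 (j - i) * (\prod_(s < j) (2 ^ (n - rank2 B) - 2 ^ s))%N%:R
    / ((2 ^ 'C(j, 2))%N%:R * qfact i * qfact (j - i))).
  by apply: eq_bigr => B sB; rewrite sum_mu2_prod // STS_dual_dim.
rewrite exchange_big mulr_sumr /= big_nat [RHS]big_nat; apply: eq_bigr => j /andP[le_ij le_jk].
have w2 : n.+1 = (2 ^ j * (n.+1 %/ 2 ^ j))%N by rewrite mulnC divnK // pfactor_dvdn.
have m_gt0 : (0 < n.+1 %/ 2 ^ j)%N.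
  by have := ltn0Sn n; rewrite [X in (0 < X)%N]w2 muln_gt0 => /andP[].
rewrite -mulr_suml -mulr_sumr -natr_sum (sum_STS_prod m_gt0 w2) -/(Phidot n.+1 j) natrM.
rewrite -(Gammadot_mul (ltn0Sn n) le_ij le_jk).
have : (2 ^ 'C(j, 2))%N%:R * qfact i * qfact (j - i) != 0.
  by rewrite !mulf_neq0 ?qfact_neq0 // pnatr_eq0 -lt0n expn_gt0.
move: (_ * _ * qfact _) (Gammadot _ _ _) (Gammadot _ _ _) (mu2 _) ((Phidot _ _)%:R : rat).
by move=> c a b x y c0; field.
Qed.
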